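(* Let $X$ be a space and $Y\subseteq X$. Then $\operatorname{TC}(X,Y)\le\operatorname{TC}(X)$.
   Context: For a continuous map (fibration) $f:E\to B$, the Schwarz genus $\operatorname{genus}(f)$ is the smallest $k$ such that $B$ has an open cover $U_1,\dots,U_k$ for which each $U_i$ admits a continuous section $s_i:U_i\to E$ of $f$ (and $\infty$ if there is no such $k$). For $Y\subseteq X$, let $P_{X\times Y}$ be the space of continuous paths $\gamma:[0,1]\to X$ with $\gamma(1)\in Y$, and let $\pi:P_{X\times Y}\to X\times Y$, $\pi(\gamma)=(\gamma(0),\gamma(1))$. The relative topological complexity of the pair is $\operatorname{TC}(X,Y)=\operatorname{genus}(\pi)$. The topological complexity of $X$ is $\operatorname{TC}(X)=\operatorname{genus}(p)$, where $p:PX\to X\times X$, $p(\sigma)=(\sigma(0),\sigma(1))$, and $PX$ is the space of all paths in $X$ (unreduced convention). *)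

(* Defs.v *)
From HB Require Import structures.
From mathcomp Require Import all_boot all_order all_algebra.
From mathcomp Require Import all_classical all_reals all_analysis.

Set Implicit Arguments.
Unset Strict Implicit.
Unset Printing Implicit Defensive.

Import Order.TTheory GRing.Theory Num.Theory.
Import numFieldNormedType.Exports.

Local Open Scope classical_set_scope.
Local Open Scope ring_scope.

Section schwarz_genus.
Context {E B : topologicalType}.

(* [U i] is coerced to the type of its elements, with the subspace topology. *)
Definition has_section_cover (f : continuousType E B) (k : nat) : Prop :=
  exists U : 'I_k -> set B,
    [/\ forall i, open (U i),
        \bigcup_i U i = [set: B] &
        forall i, exists s : U i -> E,
          continuous s /\ forall b : U i, f (s b) = \val b].

(* Unreduced: the number of open sets is counted, so genus 1 means that there
   is a global section, and genus 0 that [B] is empty.  [\bar int] only serves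
   as the naturals with [+oo] added. *)
Definition genus (f : continuousType E B) : \bar int :=
  if pselect (exists k, `[< has_section_cover f k >]) is left ex
  then ((ex_minn ex)%:Z)%:E else +oo%E.

End schwarz_genus.

Definition unit_interval (R : realType) : Type :=
  set_type (`[0, 1]%classic : set R).
HB.instance Definition _ (R : realType) := Topological.on (unit_interval R).

Lemma mem_unit_interval0 (R : realType) : 0 \in (`[0, 1]%classic : set R).
Proof. by apply/mem_set; rewrite /= in_itv/= lexx ler01. Qed.

Lemma mem_unit_interval1 (R : realType) : 1 \in (`[0, 1]%classic : set R).
Proof. by apply/mem_set; rewrite /= in_itv/= lexx ler01. Qed.

Definition I0 {R : realType} : unit_interval R :=
  exist _ 0 (mem_unit_interval0 R).
Definition I1 {R : realType} : unit_interval R :=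
  exist _ 1 (mem_unit_interval1 R).

Definition path_space (R : realType) (X : topologicalType) : Type :=
  continuousType (unit_interval R) X.

HB.instance Definition _ (R : realType) (X : topologicalType) :=
  Choice.on (path_space R X).
HB.instance Definition _ (R : realType) (X : topologicalType) :=
  Topological.copy (path_space R X)
    (initial_topology
      ((fun g => g) : path_space R X -> {compact-open, unit_interval R -> X})).

Lemma path_eval_continuous (R : realType) (X : topologicalType)
    (t : unit_interval R) :
  continuous (fun g : path_space R X => g t).
Proof.
apply/continuousP => A oA.
exists [set h : {compact-open, unit_interval R -> X} | h @` [set t] `<=` A].
  by apply: compact_open_open => //; exact: compact_set1.
by apply/seteqP; split => g /=; rewrite image_set1 sub1set inE.
Qed.

Definition endpoints (R : realType) (X : topologicalType)
  (g : path_space R X) : X * X := (g I0, g I1).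

Lemma endpoints_continuous (R : realType) (X : topologicalType) :
  continuous (@endpoints R X).
Proof.
move=> g; have c0 := @path_eval_continuous R X I0 g.
by have c1 := @path_eval_continuous R X I1 g; exact: (cvg_pair c0 c1).
Qed.

HB.instance Definition _ (R : realType) (X : topologicalType) :=
  isContinuous.Build _ _ (@endpoints R X) (@endpoints_continuous R X).

Definition TC (R : realType) (X : topologicalType) : \bar int :=
  genus (@endpoints R X).

Definition paths_ending_in (R : realType) (X : topologicalType) (Y : set X) :
  set (path_space R X) := [set g | Y (g I1)].
Arguments paths_ending_in R {X} Y.

Definition rel_endpoints (R : realType) (X : topologicalType) (Y : set X)
    (g : paths_ending_in R Y) : X * Y :=
  ((\val g : path_space R X) I0,
   exist _ ((\val g : path_space R X) I1) (mem_set (set_valP g))).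

Lemma rel_endpoints_continuous (R : realType) (X : topologicalType)
    (Y : set X) :
  continuous (@rel_endpoints R X Y).
Proof.
have cev t : continuous (fun g : paths_ending_in R Y =>
    (\val g : path_space R X) t).
  apply/continuousP => A oA.
  exists [set g : path_space R X | A (g t)] => //.
  by have /continuousP/(_ A oA) := @path_eval_continuous R X t.
have cY : continuous (fun g : paths_ending_in R Y => (rel_endpoints g).2).
  apply/continuousP => _ [A oA <-].
  by have /continuousP/(_ A oA) := cev I1.
by move=> g; exact: (cvg_pair (cev I0 g) (cY g)).
Qed.

HB.instance Definition _ (R : realType) (X : topologicalType) (Y : set X) :=
  isContinuous.Build _ _ (@rel_endpoints R X Y)
    (@rel_endpoints_continuous R X Y).

Definition relTC (R : realType) (X : topologicalType) (Y : set X) : \bar int :=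
  genus (@rel_endpoints R X Y).
Arguments relTC R {X} Y.

(* Main.v *)
Require Import Defs.
From mathcomp Require Import all_boot all_order all_algebra.
From mathcomp Require Import all_classical all_reals all_analysis.

(** The fibration [rel_endpoints R Y] is the pullback of [endpoints] along the
    inclusion of X * Y into X * X: a path in X ending in Y is the same thing as
    a path in X together with a point of X * Y giving its two ends.  Pulling
    back never increases the Schwarz genus, since the preimages of the sets of
    an open cover form an open cover of the new base, and a section over U
    followed through the universal property of the pullback is a section over
    the preimage of U.  Hence every cover counted by TC(X) yields a cover of
    the same size for TC(X, Y) ([has_section_cover_base_change]), and comparing
    the minimal sizes gives the inequality ([le_genus]). *)

Local Open Scope classical_set_scope.

(** The part of the universal property that produces sections of f': with Z
    an open set of B' and v its inclusion, a w as below is a section over Z. *)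
Definition weak_pullback {E B E' B' : topologicalType}
    (f : E -> B) (f' : E' -> B') (g : B' -> B) : Prop :=
  forall (Z : topologicalType) (u : Z -> E) (v : Z -> B'),
    continuous u -> continuous v -> (forall z, f (u z) = g (v z)) ->
    exists w : Z -> E', continuous w /\ forall z, f' (w z) = v z.

Lemma set_val_continuous (T : topologicalType) (A : set T) :
  continuous (\val : A -> T).
Proof. by apply/continuousP => V oV; exists V. Qed.

(** The topology of a subspace is initial for the inclusion, so continuity can
    be tested after forgetting the subspace. *)
Lemma continuous_into_set (Z T : topologicalType) (A : set T) (h : Z -> A) :
  continuous (fun z => \val (h z)) -> continuous h.
Proof.
by move=> ch; apply/continuousP => _ [V oV <-]; move/continuousP: ch => /(_ V oV).
Qed.

(** Over the preimage of U_i, the lift is taken for u the section over U_i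
    precomposed with the restriction r of g, and for v the inclusion. *)
Lemma has_section_cover_base_change (E B E' B' : topologicalType)
    (f : continuousType E B) (f' : continuousType E' B') (g : B' -> B)
    (k : nat) :
  continuous g -> weak_pullback f f' g ->
  has_section_cover f k -> has_section_cover f' k.
Proof.
move=> cg pb [U [oU covU secU]]; exists (fun i => g @^-1` U i); split.
- by move=> i; move/continuousP: cg => /(_ _ (oU i)).
- apply/seteqP; split => // b _.
  have : (\bigcup_i U i) (g b) by rewrite covU.
  by case=> i _ Ui; exists i.
- move=> i; have [s [cs fs]] := secU i.
  pose r (b : (g @^-1` U i : set B')) : U i :=
    exist _ (g (\val b)) (mem_set (set_valP b)).
  have cr : continuous r.
    apply: continuous_into_set => b.
    exact: (continuous_comp (@set_val_continuous _ _ b) (cg _)).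
  apply: (pb _ (s \o r) _ _ (@set_val_continuous _ _)).
    by move=> b; apply: continuous_comp; [exact: cr | exact: cs].
  by move=> b; rewrite /= fs.
Qed.

Lemma le_genus (E B E' B' : topologicalType)
    (f : continuousType E B) (f' : continuousType E' B') :
  (forall k, has_section_cover f k -> has_section_cover f' k) ->
  (genus f' <= genus f)%E.
Proof.
move=> ff'; rewrite /genus.
case: (pselect (exists k, `[< has_section_cover f k >])) => [ex|_];
  last by rewrite leey.
case: pselect => [ex'|]; last first.
  by case: ex => k /asboolP /ff' /asboolP ? []; exists k.
rewrite lee_fin lez_nat; case: (ex_minnP ex) => n /asboolP /ff' /asboolP fn _.
by case: ex_minnP => m _; apply.
Qed.

(** The agreement of u and v over X * X already forces each path u z to end
    in Y, so u itself, corestricted, is the required lift of v. *)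
Lemma rel_endpoints_weak_pullback (R : realType) (X : topologicalType)
    (Y : set X) :
  weak_pullback (@endpoints R X) (@rel_endpoints R X Y)
    (fun p : X * Y => (p.1, \val p.2)).
Proof.
move=> Z u v cu cv uv.
have uY z : paths_ending_in R Y (u z).
  by have [_ uI1] := uv z; rewrite /paths_ending_in /= uI1; exact: set_valP.
exists (fun z => exist _ (u z) (mem_set (uY z))); split.
  exact: continuous_into_set.
move=> z; have [u0 u1] := uv z.
by rewrite [RHS]surjective_pairing; congr pair => //; apply: val_inj.
Qed.

Theorem corollary2p6 (R : realType) (X : topologicalType) (Y : set X) :
  (relTC R Y <= TC R X)%E.
Proof.
apply: le_genus => k; apply: has_section_cover_base_change.
  move=> p; have c1 : fst q @[q --> p] --> p.1 by exact: cvg_fst.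
  have c2 : \val (snd q) @[q --> p] --> \val p.2.
    by apply: continuous_comp; [exact: cvg_snd | exact: set_val_continuous].
  exact: (cvg_pair c1 c2).
exact: rel_endpoints_weak_pullback.
Qed.
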